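(* Let $A\in\mathbb{R}^{M\times N}$ with $M<N$ have nonzero columns. For arbitrarily fixed $\omega\in\Omega_{\max}$ and $\beta>0$, the family of functions $\{F_d: d\in\mathbb{R}^M\}$, $F_d(u)=\|Au-d\|_2^2+\beta\|u\|_0$, has a linear (local) minimizer function $\mathcal U:\mathbb{R}^M\to\mathbb{R}^N$ that reads $$\forall d\in\mathbb{R}^M,\quad \mathcal U(d)=Z_\omega(U_\omega d),\quad\text{where}\quad U_\omega=\left(A_\omega^TA_\omega\right)^{-1}A_\omega^T\in\mathbb{R}^{\#\omega\times M}.$$
   Context: $\|u\|_0$ is the number of nonzero entries of $u\in\mathbb{R}^N$. A map $\mathcal U:O\to\mathbb{R}^N$, with $O\subseteq\mathbb{R}^M$ open, is a local minimizer function for the family $\{F_d: d\in O\}$ if for every $d\in O$ the function $F_d$ reaches a strict (local) minimum at $\mathcal U(d)$, i.e. there is a neighborhood $V$ of $\mathcal U(d)$ with $F_d(\mathcal U(d))<F_d(v)$ for all $v\in V\setminus\{\mathcal U(d)\}$. For $\omega\subseteq\{1,\dots,N\}$ (listed in increasing order), $A_\omega\in\mathbb{R}^{M\times\#\omega}$ is the submatrix of $A$ formed by the columns indexed by $\omega$, $A_\omega^T=(A_\omega)^T$, and $Z_\omega:\mathbb{R}^{\#\omega}\to\mathbb{R}^N$ is zero padding: $Z_\omega(w)[\omega[k]]=w[k]$ and $Z_\omega(w)[i]=0$ for $i\notin\omega$. Conventions: $A_\varnothing\in\mathbb{R}^{M\times0}$, $\operatorname{rank}(A_\varnothing)=0$,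 and $Z_\varnothing$ gives $0\in\mathbb{R}^N$. For $r\in\{1,\dots,M\}$, $\Omega_r=\{\omega\subset\{1,\dots,N\}:\#\omega=r=\operatorname{rank}(A_\omega)\}$; $\Omega_0=\{\varnothing\}$; $\Omega_{\max}=\bigcup_{r=0}^{M}\Omega_r$. *)

(* Defs.v *)
From HB Require Import structures.
From mathcomp Require Import all_boot all_order all_algebra.
From mathcomp Require Import all_classical all_reals all_analysis.
Set Implicit Arguments.
Unset Strict Implicit.
Unset Printing Implicit Defensive.
Import Order.TTheory GRing.Theory Num.Theory.
Import numFieldNormedType.Exports.
Local Open Scope ring_scope.

Definition norm2 (R : realType) (n : nat) (v : 'cV[R]_n) : R :=
  Num.sqrt (\sum_i `|v i 0| ^+ 2).

Definition l0norm (R : realType) (n : nat) (v : 'cV[R]_n) : nat :=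
  #|[set i : 'I_n | v i 0 != 0]%SET|.

(* Library balls on matrices are sup-norm balls; in finite dimension [nbhs] is
   the usual Euclidean topology. *)
Definition strict_local_min (R : realType) (n : nat)
    (f : 'cV[R]_n -> R) (x : 'cV[R]_n) : Prop :=
  exists2 V : set 'cV[R]_n, nbhs x V &
    forall v : 'cV[R]_n, V v -> v <> x -> f x < f v.

(* The minimizer function is a total map of which only the values on [O]
   matter. *)
Definition local_minimizer_function (R : realType) (m n : nat)
    (O : set 'cV[R]_m) (F : 'cV[R]_m -> 'cV[R]_n -> R)
    (U : 'cV[R]_m -> 'cV[R]_n) : Prop :=
  open O /\ forall d : 'cV[R]_m, O d -> strict_local_min (F d) (U d).

Section Support.
Variables (R : realType) (m n : nat).
Implicit Types (A : 'M[R]_(m, n)) (omega : {set 'I_n}).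

(* [enum_val] lists [omega] in increasing order, see [ltn_enum_val]. *)
Definition subcols A omega : 'M[R]_(m, #|omega|) :=
  colsub (fun k : 'I_#|omega| => enum_val k) A.

Definition zero_pad omega (w : 'cV[R]_#|omega|) : 'cV[R]_n :=
  \col_i (if [pick k : 'I_#|omega| | enum_val k == i] is Some k
          then w k 0 else 0).

Definition Omega A (r : nat) : {set {set 'I_n}} :=
  if r == 0%N then [set finset.set0]%SET
  else [set omega : {set 'I_n} |
         (#|omega| == r) && (\rank (subcols A omega) == r)]%SET.

Definition Omega_max A : {set {set 'I_n}} :=
  (\bigcup_(r < m.+1) Omega A r)%SET.

(* [invmx] is a genuine inverse here only when the columns indexed by [omega]
   are linearly independent, which holds for [omega] in [Omega_max A]. *)
Definition lsq_mx A omega : 'M[R]_(#|omega|, m) :=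
  invmx ((subcols A omega)^T *m subcols A omega) *m (subcols A omega)^T.

Definition objective A (beta : R) (d : 'cV[R]_m) (u : 'cV[R]_n) : R :=
  norm2 (A *m u - d) ^+ 2 + beta * (l0norm u)%:R.

Lemma ltn_enum_val omega :
  {mono (fun k : 'I_#|omega| => enum_val k) : k l / (k < l)%N}.
Proof.
move=> k l; have incr (i j : 'I_#|omega|) : (i < j)%N ->
    (enum_val i < enum_val j)%N.
  move=> ij; have sj : (j < size (enum omega))%N by rewrite -cardE.
  have x0 : 'I_n := enum_val i.
  have si : (i < size (enum omega))%N by exact: ltn_trans sj.
  rewrite !(enum_val_nth x0) -!(nth_map x0 0%N (@nat_of_ord n)) //.
  apply: (sorted_ltn_nth ltn_trans) => //; rewrite ?inE ?size_map //.
  rewrite /enum_mem -enumT; apply: (@subseq_sorted _ ltn ltn_trans _ (iota 0 n)).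
    by rewrite -val_enum_ord; apply: map_subseq; exact: filter_subseq.
  exact: iota_ltn_sorted.
have [kl|lk|/val_inj ->] := ltngtP k l; last by rewrite ltnn.
  exact: incr.
by apply/negbTE; rewrite -leqNgt ltnW // incr.
Qed.

Lemma zero_pad_enum_val omega (w : 'cV[R]_#|omega|) (k : 'I_#|omega|) :
  zero_pad w (enum_val k) 0 = w k 0.
Proof.
rewrite mxE; case: pickP => [j /eqP/enum_val_inj -> //|/(_ k)].
by rewrite eqxx.
Qed.

Lemma zero_pad_notin omega (w : 'cV[R]_#|omega|) (i : 'I_n) :
  i \notin omega -> zero_pad w i 0 = 0.
Proof.
move=> iNo; rewrite mxE; case: pickP => // k /eqP ki.
by rewrite -ki enum_valP in iNo.
Qed.

End Support.

(* Main.v *)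
(* Near [u = zero_pad w] the support can only grow. If it grows, the jump of at
   least [beta] in the [l0] term beats the continuous quadratic term; if it does
   not, [v - u] is supported in [omega], and the normal equations make
   [A (v - u)], nonzero by full rank, orthogonal to the residual [A u - d], so
   that Pythagoras gives the strict inequality. *)

Require Import Defs.
From HB Require Import structures.
From mathcomp Require Import all_boot all_order all_algebra.
From mathcomp Require Import all_classical all_reals all_analysis.
Set Implicit Arguments.
Unset Strict Implicit.
Unset Printing Implicit Defensive.
Import Order.TTheory GRing.Theory Num.Theory.
Import numFieldNormedType.Exports.
Local Open Scope ring_scope.

Section Norm2.
Variables (R : realType) (n : nat).
Implicit Types v x y : 'cV[R]_n.

Lemma norm2_sqrE v : norm2 v ^+ 2 = \sum_i v i 0 ^+ 2.
Proof.
rewrite /norm2 sqr_sqrtr; last by apply: sumr_ge0 => i _; rewrite exprn_ge0.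
by apply: eq_bigr => i _; rewrite real_normK ?num_real.
Qed.

Lemma norm2_sqr_mulmx v : norm2 v ^+ 2 = (v^T *m v) 0 0.
Proof.
by rewrite norm2_sqrE mxE; apply: eq_bigr => i _; rewrite mxE -expr2.
Qed.

Lemma norm2_sqr_eq0 v : (norm2 v ^+ 2 == 0) = (v == 0).
Proof.
rewrite norm2_sqrE psumr_eq0; last by move=> i _; exact: sqr_ge0.
apply/allP/eqP => [v0|-> i _]; last by rewrite /= mxE expr0n eqxx.
apply/colP => i; apply/eqP; rewrite mxE -sqrf_eq0.
by apply: v0; rewrite mem_index_enum.
Qed.

(** Pythagoras; the second cross term is the transpose of the one assumed to vanish. *)
Lemma norm2_sqrD x y :
  y^T *m x = 0 -> norm2 (x + y) ^+ 2 = norm2 x ^+ 2 + norm2 y ^+ 2.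
Proof.
move=> yx0; have xy0 : x^T *m y = 0.
  by apply: trmx_inj; rewrite trmx_mul trmxK yx0 trmx0.
rewrite !norm2_sqr_mulmx [(_ + _)^T]linearD /= mulmxDl !mulmxDr.
by rewrite xy0 yx0 addr0 add0r mxE.
Qed.

End Norm2.

(** A row [v] killed by the Gram matrix satisfies [v *m B^T *m B *m v^T = 0]. This is the squared
    norm of [(v *m B^T)^T], so [v *m B^T = 0], and full column rank of [B] forces [v = 0]. *)
Lemma gram_unitmx (R : realType) (m n : nat) (B : 'M[R]_(m, n)) :
  \rank B = n -> B^T *m B \in unitmx.
Proof.
move=> rkB; have fB : row_free B^T by rewrite /row_free mxrank_tr rkB.
rewrite -row_free_unit; apply: inj_row_free => v vG0.
apply/eqP; rewrite -(mulmx_free_eq0 _ fB) -(inj_eq trmx_inj) trmx0.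
rewrite -norm2_sqr_eq0 norm2_sqr_mulmx trmxK trmx_mul trmxK.
by rewrite mulmxA -(mulmxA v) vG0 mul0mx mxE.
Qed.

Section ZeroPad.
Variables (R : realType) (n : nat) (omega : {set 'I_n}).

Lemma zero_pad_is_linear : linear (@zero_pad R n omega).
Proof.
move=> a v w; apply/colP => i; rewrite !mxE.
by case: pickP => [k _|_]; rewrite ?mxE // mulr0 addr0.
Qed.

(** Lets the composite of [zero_pad] with a matrix product be inferred linear. *)
HB.instance Definition _ :=
  GRing.isLinear.Build R 'cV[R]_#|omega| 'cV[R]_n _ (@zero_pad R n omega)
    zero_pad_is_linear.

Lemma zero_padK (v : 'cV[R]_n) : (forall i, i \notin omega -> v i 0 = 0) ->
  zero_pad (\col_(k < #|omega|) v (enum_val k) 0) = v.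
Proof.
move=> v0; apply/colP => i; case: (boolP (i \in omega)) => [iw|iNw].
  by rewrite -(enum_rankK_in iw iw) zero_pad_enum_val mxE.
by rewrite zero_pad_notin // v0.
Qed.

Lemma mulmx_zero_pad m (A : 'M[R]_(m, n)) (w : 'cV[R]_#|omega|) :
  A *m zero_pad w = subcols A omega *m w.
Proof.
apply/colP => i; rewrite !mxE (bigID [in omega]) /= [X in _ + X]big1 ?addr0.
  rewrite big_enum_val; apply: eq_bigr => k _.
  by rewrite zero_pad_enum_val mxE.
by move=> j jNw; rewrite zero_pad_notin // mulr0.
Qed.

End ZeroPad.

Lemma rank_Omega_max (R : realType) (m n : nat) (A : 'M[R]_(m, n)) omega :
  omega \in Omega_max A -> \rank (subcols A omega) = #|omega|.
Proof.
move=> /bigcupP[r _]; rewrite /Omega; case: ifP => _; rewrite inE.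
  (* Case [r = 0]: [omega] is empty and the rank is bounded by the number of columns, zero. *)
  move=> /eqP->; have := rank_leq_col (subcols A finset.set0).
  by rewrite [X in (_ <= X)%N]cards0 leqn0 => /eqP->; rewrite cards0.
by move=> /andP[/eqP omega_r /eqP ->].
Qed.

(** The squared norm is a sum of squares of affine functions of the coordinates, so sums and
    products of continuous maps suffice. *)
Lemma continuous_norm2_sqr_affine (R : realType) (m n : nat)
    (A : 'M[R]_(m, n)) (d : 'cV[R]_m) :
  continuous (fun v : 'cV[R]_n => norm2 (A *m v - d) ^+ 2).
Proof.
under eq_fun do rewrite norm2_sqrE.
apply: continuous_big => [|i _]; first exact: add_continuous.
have c : continuous (fun v : 'cV[R]_n => (A *m v - d) i 0).
  under eq_fun do rewrite !mxE.
  move=> u; apply: continuousB; last exact: cst_continuous.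
  apply: continuous_big u => [|j _ u]; first exact: add_continuous.
  by apply: continuousM; [exact: cst_continuous|exact: coord_continuous].
by under eq_fun do rewrite expr2; move=> u; exact: continuousM (c u) (c u).
Qed.

(** Each nonzero coordinate stays nonzero nearby by continuity, and there are finitely many
    coordinates. *)
Lemma nbhs_support_subset (R : realType) (n : nat) (u : 'cV[R]_n) :
  nbhs u [set v : 'cV[R]_n | forall i, u i 0 != 0 -> v i 0 != 0]%classic.
Proof.
apply: (@filter_forall _ _ (fun i (v : 'cV[R]_n) => u i 0 != 0 -> v i 0 != 0)
  (nbhs u) (nbhs_filter u)) => i.
have [_|ui0] := eqVneq (u i 0) 0; first exact: nearW.
have /(_ (nbhs_filter u)) :=
  cvgr_neq0 (u i 0) (@coord_continuous R n 1 i 0 u) ui0.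
by apply: filterS => v vi0 _.
Qed.

(** Stated for any solution [w] of the normal equations, so that the explicit inverse enters only in
    the theorem. *)
Lemma strict_local_min_zero_pad (R : realType) (m n : nat)
    (A : 'M[R]_(m, n)) (omega : {set 'I_n}) (beta : R) (d : 'cV[R]_m)
    (w : 'cV[R]_#|omega|) :
  0 < beta -> \rank (subcols A omega) = #|omega| ->
  (subcols A omega)^T *m (subcols A omega *m w - d) = 0 ->
  strict_local_min (objective A beta d) (zero_pad w).
Proof.
move=> beta0 rkA; rewrite -mulmx_zero_pad; set u := zero_pad w => normal_eq.
exists [set v : 'cV[R]_n | (forall i, u i 0 != 0 -> v i 0 != 0) /\
    norm2 (A *m u - d) ^+ 2 - beta < norm2 (A *m v - d) ^+ 2]%classic.
  apply: filterI; first exact: nbhs_support_subset.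
  apply: (cvgr_gt _ (@continuous_norm2_sqr_affine R m n A d u)).
  by rewrite ltrBlDr ltrDl.
move=> v [supp_uv v_lb] v_neq_u; rewrite /objective.
set Su := [set i | u i 0 != 0]%SET; set Sv := [set i | v i 0 != 0]%SET.
have sSuv : Su \subset Sv.
  by apply/fintype.subsetP => i; rewrite !inE; exact: supp_uv.
have [Suv|/negbTE Suv] := boolP (Su == Sv); last first.
  have l0_lt : (l0norm u < l0norm v)%N.
    by rewrite /l0norm proper_card // finset.properEneq Suv.
  (* The quadratic term drops by less than [beta], while the [l0norm] term gains at least [beta]. *)
  rewrite -ltrBlDr (le_lt_trans _ v_lb) // -addrA lerD2l.
  rewrite lerBlDr -lerBlDl opprK -{2}(mulr1 beta) -mulrDr ler_pM2l //.
  by rewrite natr1 ler_nat.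
have -> : l0norm v = l0norm u by rewrite /l0norm -/Sv -/Su (eqP Suv).
rewrite ltrD2r.
(* The support of [u] may be strictly smaller than [omega]; equality of supports still makes [v]
   vanish off [omega]. *)
have h_supp i : i \notin omega -> (v - u) i 0 = 0.
  move=> iNw; have ui0 : u i 0 = 0 by exact: zero_pad_notin.
  have : i \notin Sv by rewrite -(eqP Suv) inE ui0 eqxx.
  by rewrite inE negbK => /eqP vi0; rewrite mxE vi0 add0r mxE ui0 oppr0.
have [h hE] : exists h : 'cV[R]_#|omega|, v - u = zero_pad h.
  by exists (\col_k (v - u) (enum_val k) 0); rewrite zero_padK.
have Av : A *m v - d = (A *m u - d) + subcols A omega *m h.
  by rewrite -mulmx_zero_pad -hE mulmxBr [RHS]addrC addrA subrK.
rewrite Av [ltRHS]norm2_sqrD; last by rewrite trmx_mul -mulmxA normal_eq mulmx0.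
rewrite ltrDl lt0r sqr_ge0 andbT norm2_sqr_eq0.
(* If the added square were zero, full column rank would give [h = 0], hence [v = u]. *)
apply/eqP => Bh0; apply: v_neq_u; apply/eqP; rewrite -subr_eq0 hE.
have fB : row_free (subcols A omega)^T by rewrite /row_free mxrank_tr rkA.
suff -> : h = 0 by rewrite linear0.
apply: trmx_inj; apply/eqP; rewrite trmx0 -(mulmx_free_eq0 _ fB) -trmx_mul.
by rewrite Bh0 trmx0.
Qed.

Theorem lemma3p6 (R : realType) (M N : nat) (A : 'M[R]_(M, N))
    (ltMN : (M < N)%N) (A_col_neq0 : forall j : 'I_N, col j A != 0)
    (omega : {set 'I_N}) (omegaP : omega \in Omega_max A)
    (beta : R) (beta_gt0 : 0 < beta) :
  exists U : {linear 'cV[R]_M -> 'cV[R]_N},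
    local_minimizer_function setT (objective A beta) U /\
    forall d : 'cV[R]_M, U d = zero_pad (lsq_mx A omega *m d).
Proof.
have rkA := rank_Omega_max omegaP.
exists (@zero_pad R N omega \o mulmx (lsq_mx A omega)); split=> //.
split=> [|d _ /=]; first exact: openT.
apply: strict_local_min_zero_pad => //.
(* The Gram matrix cancels against its inverse, which leaves the normal equations. *)
by rewrite mulmxBr /lsq_mx !mulmxA mulmxV ?gram_unitmx // mul1mx subrr.
Qed.
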